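(* For every $n\in\mathbb{N}$, $$C_n=\sup_{A\in\mathcal{S}_+^n\setminus\{0\}}\frac{\gamma_+(A)}{\|A\|_{1,1}}=\sup_{T\in\mathcal{S}^n\setminus\{0\}}\frac{\pi_+(T)}{\rho_1(T)},$$ where the convention $\frac{0}{0}=0$ is used.
   Context: Let $\mathbb{F}$ be $\mathbb{R}$ or $\mathbb{C}$. $\mathcal{S}^n$ is the real vector space of self-adjoint (symmetric or Hermitian) $n\times n$ matrices over $\mathbb{F}$ and $\mathcal{S}_+^n\subset\mathcal{S}^n$ the cone of positive semidefinite matrices. $\|x\|_1=\sum_i|x(i)|$ for $x\in\mathbb{F}^n$ and $\|A\|_{1,1}=\sum_{k,l=1}^n|A(k,l)|$. For $A\in\mathcal{S}_+^n$, $\gamma_+(A) := \inf\{\sum_{k=1}^N \|x_k\|_1^2 : N\in\mathbb{N},\ x_k\in\mathbb{F}^n,\ A = \sum_{k=1}^N x_kx_k^*\}$. $C_n$ is defined by $C_n:=\sup_{A\in\mathcal{S}_+^n\setminus\{0\}}\gamma_+(A)/\|A\|_{1,1}$. For $T\in\mathcal{S}^n$, $\rho_1(T):=\sup\{\langle Tx,x\rangle : x\in\mathbb{F}^n,\ \|x\|_1\le 1\}$ and $\pi_+(T):=\sup\{\mathrm{tr}(TA): A\in\mathcal{S}_+^n,\ \|A\|_{1,1}\le 1\}$. *)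

(* Defs.v *)
From HB Require Import structures.
From mathcomp Require Import all_boot all_order all_algebra.
From mathcomp Require Import complex.
From mathcomp Require Import all_classical all_reals ereal.

Set Implicit Arguments.
Unset Strict Implicit.
Unset Printing Implicit Defensive.

Import Order.TTheory GRing.Theory Num.Theory.
Local Open Scope classical_set_scope.
Local Open Scope ring_scope.
Local Open Scope sesquilinear_scope.

Variant scalar_kind := RealScalars | ComplexScalars.

Definition scalar_field (R : realType) (K : scalar_kind) : numFieldType :=
  match K with RealScalars => R | ComplexScalars => R[i] end.

Definition scalar_conj (R : realType) (K : scalar_kind) :
    {rmorphism scalar_field R K -> scalar_field R K} :=
  match K with RealScalars => idfun | ComplexScalars => Num.conj end.

Definition scalar_re (R : realType) (K : scalar_kind) : scalar_field R K -> R :=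
  match K with RealScalars => idfun | ComplexScalars => @complex.Re R end.

Section Gauges.
Context (R : realType) (K : scalar_kind).
Local Notation F := (scalar_field R K).
Local Notation conj := (scalar_conj R K).
Local Notation re := (@scalar_re R K).

Definition adjmx (m n : nat) (A : 'M[F]_(m, n)) : 'M[F]_(n, m) := A ^t conj.

(* In MathComp the norm of a complex number is itself a (real) complex number,
   hence [re] in the two norms below. *)
Definition l1norm (n : nat) (x : 'cV[F]_n) : R := \sum_i re `|x i 0|.

Definition l11norm (n : nat) (A : 'M[F]_n) : R :=
  \sum_k \sum_l re `|A k l|.

Definition selfadj (n : nat) : set 'M[F]_n :=
  [set A | A \is hermitianmx n false conj].

(* <Tx, x> = x^* T x, which is real when T is self-adjoint. *)
Definition qform (n : nat) (T : 'M[F]_n) (x : 'cV[F]_n) : R :=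
  re ((adjmx x *m T *m x) 0 0).

Definition psd (n : nat) : set 'M[F]_n :=
  [set A | selfadj A /\ forall x : 'cV[F]_n, 0 <= qform A x].

Definition gamma_plus (n : nat) (A : 'M[F]_n) : \bar R :=
  ereal_inf [set s | exists (N : nat) (x : 'I_N -> 'cV[F]_n),
    A = \sum_k x k *m adjmx (x k) /\ s = (\sum_k l1norm (x k) ^+ 2)%:E].

Definition rho1 (n : nat) (T : 'M[F]_n) : \bar R :=
  ereal_sup [set (qform T x)%:E | x in [set x : 'cV[F]_n | l1norm x <= 1]].

(* tr (T A) is real when T and A are self-adjoint. *)
Definition pi_plus (n : nat) (T : 'M[F]_n) : \bar R :=
  ereal_sup [set (re (\tr (T *m A)))%:E |
    A in [set A : 'M[F]_n | psd A /\ l11norm A <= 1]].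

Definition gamma_const (n : nat) : \bar R :=
  ereal_sup [set (gamma_plus A / (l11norm A)%:E)%E |
    A in @psd n `\ (0 : 'M[F]_n)].

End Gauges.

(* In [\bar R], 0^-1 = +oo and 0 * +oo = 0. *)
Lemma ereal_div00 (R : realType) : (0 / 0 = 0 :> \bar R)%E.
Proof. by rewrite inve0 mul0e. Qed.

(* Main.v *)
(** By homogeneity both suprema reduce to the duality
    gamma_+(A) = sup { tr (T A) : rho_1(T) <= 1 }, needed only up to a factor
    1 + eps.  Since tr (T x x^* ) = <Tx, x>, the inequality ">=" is immediate.
    For the converse, gamma_+ is extended to all matrices by the finite sublinear
    functional
      p(B) = inf { (1 + eps) sum_k |x_k|_1^2 + M |B - sum_k x_k x_k^*|_{1,1} },
    which satisfies p(x x^* ) <= (1 + eps) |x|_1^2; Hahn-Banach at A then yields T.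
    That p(A) >= gamma_+(A) for large M is a quantitative lower semicontinuity of
    gamma_+, proved without compactness by compressing the decompositions of
    nearby matrices to the range of A. *)

Require Import Defs.
From HB Require Import structures.
From mathcomp Require Import all_boot all_order all_algebra.
From mathcomp Require Import complex.
From mathcomp Require Import all_classical all_reals ereal.
From mathcomp Require Import ring lra.

Set Implicit Arguments.
Unset Strict Implicit.
Unset Printing Implicit Defensive.

Import Order.TTheory GRing.Theory Num.Theory.
Local Open Scope classical_set_scope.
Local Open Scope ring_scope.

(** * Real and complex scalars treated uniformly *)

Section Scalars.
Context (R : realType) (K : scalar_kind).
Local Notation F := (scalar_field R K).
Local Notation conj := (scalar_conj R K).
Local Notation re := (@scalar_re R K).
Implicit Types (z w : F) (r : R).

(** Together with [re], this lets F be handled as a real vector space for either [K]; case analysis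
    on [K] stays within this section and the next. *)
Definition scalar_emb : {rmorphism R -> F} :=
  match K with RealScalars => idfun | ComplexScalars => real_complex R end.
Local Notation emb := scalar_emb.

Lemma scalar_reD : {morph re : z w / z + w}.
Proof. by rewrite /scalar_re; case: K => // -[a b] [c d]. Qed.

Lemma scalar_reM_emb r z : re (emb r * z) = r * re z.
Proof.
rewrite /scalar_emb /scalar_re; case: K z => //= -[a b].
by rewrite /= mul0r subr0.
Qed.

Lemma scalar_re_emb r : re (emb r) = r.
Proof. by rewrite /scalar_emb /scalar_re; case: K. Qed.

Lemma scalar_conjK : involutive conj.
Proof. by case: K => //= z; rewrite conjCK. Qed.

Lemma scalar_re_conj z : re (conj z) = re z.
Proof. by case: K z => //= -[a b]. Qed.

Lemma scalar_conj_emb r : conj (emb r) = emb r.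
Proof. by rewrite /scalar_emb; case: K => //=; exact: conjc_real. Qed.

Lemma scalar_conj_fixed z : conj z = z -> z = emb (re z).
Proof.
rewrite /scalar_emb; case: K z => //= -[a b] [bN].
by have -> : b = 0 by lra.
Qed.

Lemma scalar_mul_conj z : z * conj z = emb (re `|z| ^+ 2).
Proof.
rewrite /scalar_emb; case: K z => [z|z] /=; first by rewrite real_normK ?num_real.
by rewrite rmorphXn; exact/esym/normCK.
Qed.

Lemma scalar_norm_emb z : `|z| = emb (re `|z|).
Proof.
by rewrite /scalar_emb; case: K z.
Qed.

Lemma scalar_norm_conj z : `|conj z| = `|z|.
Proof. by case: K z => //= z; rewrite norm_conjC. Qed.

Lemma scalar_re_le_norm z : re z <= re `|z|.
Proof.
case: K z => [z|z] /=; first exact: ler_norm.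
by have := normc_ge_Re z; rewrite lecE => /andP[_]; apply/le_trans/ler_norm.
Qed.

Lemma scalar_riesz (f : F -> R) : {morph f : z w / z + w} ->
  (forall r z, f (emb r * z) = r * f z) -> exists t, forall z, f z = re (t * z).
Proof.
rewrite /scalar_emb; case: K f => [|] /= f fD fZ.
  by exists (f 1) => z; rewrite -{1}[z]mulr1 fZ mulrC.
(* $\mathrm{Re}((p-iq)(a+ib))=pa+qb$, with $p=f(1)$ and $q=f(i)$. *)
exists (f 1 -i* f 'i%C)%C => -[a b] /=.
rewrite {1}[(a +i* b)%C]complexE fD -[(_)%:C%C]mulr1 fZ mulrC.
by rewrite [X in _ + f X]mulrC fZ /=; ring.
Qed.
End Scalars.

Section ScalarNorm.
Context (R : realType) (K : scalar_kind).
Local Notation F := (scalar_field R K).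
Local Notation re := (@scalar_re R K).
Local Notation emb := (scalar_emb R K).
Implicit Types (z w : F) (r : R).

Lemma scalar_re0 : re 0 = 0.
Proof. by rewrite -(rmorph0 emb) scalar_re_emb. Qed.

Lemma scalar_reN z : re (- z) = - re z.
Proof. by rewrite -mulN1r -(rmorphN1 emb) scalar_reM_emb mulN1r. Qed.

Lemma scalar_re_sum I (r : seq I) (P : pred I) (f : I -> F) :
  re (\sum_(i <- r | P i) f i) = \sum_(i <- r | P i) re (f i).
Proof. exact: (big_morph re (@scalar_reD R K) scalar_re0). Qed.

Lemma scalar_re_homo z w : z <= w -> re z <= re w.
Proof. by case: K z w => //= z w; rewrite lecE => /andP[]. Qed.

Lemma scalar_norm_ge0 z : 0 <= re `|z|.
Proof. by have := scalar_re_homo (normr_ge0 z); rewrite scalar_re0. Qed.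

Lemma scalar_normD z w : re `|z + w| <= re `|z| + re `|w|.
Proof. by rewrite -scalar_reD; apply: scalar_re_homo; exact: ler_normD. Qed.

Lemma scalar_normM z w : re `|z * w| = re `|z| * re `|w|.
Proof. by rewrite normrM {1}scalar_norm_emb scalar_reM_emb. Qed.

Lemma scalar_norm_sum I (r : seq I) (P : pred I) (f : I -> F) :
  re `|\sum_(i <- r | P i) f i| <= \sum_(i <- r | P i) re `|f i|.
Proof. by rewrite -scalar_re_sum; apply: scalar_re_homo; exact: ler_norm_sum. Qed.

Lemma scalar_norm_eq0 z : (re `|z| == 0) = (z == 0).
Proof.
apply/eqP/eqP => [z0|->]; last by rewrite normr0 scalar_re0.
by apply/eqP; rewrite -normr_eq0 scalar_norm_emb z0 rmorph0.
Qed.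

Lemma scalar_emb_ge0 r : 0 <= r -> 0 <= emb r.
Proof. by rewrite /scalar_emb; case: K => //=; rewrite ler0c. Qed.

Lemma scalar_norm_embM r z : 0 <= r -> re `|emb r * z| = r * re `|z|.
Proof.
by move=> r0; rewrite normrM ger0_norm ?scalar_emb_ge0 // scalar_reM_emb.
Qed.
End ScalarNorm.

(** * Adjoints and the entrywise l1 norm *)

Section EntryNorm.
Context (R : realType) (K : scalar_kind).
Local Notation F := (scalar_field R K).
Local Notation conj := (scalar_conj R K).
Local Notation re := (@scalar_re R K).
Local Notation emb := (scalar_emb R K).
Local Notation adj := (@adjmx R K _ _).

Lemma adjmxE m n (A : 'M[F]_(m, n)) i j : adj A i j = conj (A j i).
Proof. by rewrite /adjmx !mxE. Qed.

Lemma adjmxK m n (A : 'M[F]_(m, n)) : adj (adj A) = A.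
Proof. by apply/matrixP => i j; rewrite !adjmxE scalar_conjK. Qed.

Lemma adjmxD m n (A B : 'M[F]_(m, n)) : adj (A + B) = adj A + adj B.
Proof. by apply/matrixP => i j; rewrite !(adjmxE, mxE) rmorphD. Qed.

Lemma adjmxN m n (A : 'M[F]_(m, n)) : adj (- A) = - adj A.
Proof. by apply/matrixP => i j; rewrite !(adjmxE, mxE) rmorphN. Qed.

Lemma adjmx0 m n : adj (0 : 'M[F]_(m, n)) = 0.
Proof. by apply/matrixP => i j; rewrite !(adjmxE, mxE) rmorph0. Qed.

Lemma adjmx1 n : adj (1%:M : 'M[F]_n) = 1%:M.
Proof. by apply/matrixP => i j; rewrite !(adjmxE, mxE) rmorph_nat eq_sym. Qed.

Lemma adjmxZ m n r (A : 'M[F]_(m, n)) : adj (emb r *: A) = emb r *: adj A.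
Proof.
by apply/matrixP => i j; rewrite !(adjmxE, mxE) rmorphM scalar_conj_emb.
Qed.

Lemma adjmxM m n p (A : 'M[F]_(m, n)) (B : 'M[F]_(n, p)) :
  adj (A *m B) = adj B *m adj A.
Proof. by rewrite /adjmx trmx_mul map_mxM. Qed.

(** Covers [l1norm] on columns and [l11norm] on square matrices at once, and is submultiplicative
    across shapes ([enormM]). *)
Definition enorm m n (A : 'M[F]_(m, n)) : R := \sum_i \sum_j re `|A i j|.

Lemma l11normE n (A : 'M[F]_n) : l11norm A = enorm A.
Proof. by []. Qed.

Lemma l1normE n (x : 'cV[F]_n) : l1norm x = enorm x.
Proof. by apply: eq_bigr => i _; rewrite big_ord1. Qed.

Lemma enorm_ge0 m n (A : 'M[F]_(m, n)) : 0 <= enorm A.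
Proof. by do 2!apply: sumr_ge0 => ? _; exact: scalar_norm_ge0. Qed.

Lemma enorm_gt0 m n (A : 'M[F]_(m, n)) : (0 < enorm A) = (A != 0).
Proof.
rewrite lt0r enorm_ge0 andbT; congr negb; apply/eqP/eqP => [|->].
  move/eqP; rewrite psumr_eq0 => [|i _]; last first.
    by apply: sumr_ge0 => ? _; exact: scalar_norm_ge0.
  move=> /allP A0; apply/matrixP => i j; rewrite mxE; apply/eqP.
  have := A0 i (mem_index_enum _).
  rewrite psumr_eq0 => [|? _]; last exact: scalar_norm_ge0.
  by move=> /allP/(_ j (mem_index_enum _)); rewrite scalar_norm_eq0.
by rewrite /enorm big1 // => i _; rewrite big1 // => j _; rewrite mxE normr0 scalar_re0.
Qed.

Lemma enorm0 m n : enorm (0 : 'M[F]_(m, n)) = 0.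
Proof. by apply/le_anti; rewrite enorm_ge0 leNgt enorm_gt0 eqxx. Qed.

Lemma enormD m n (A B : 'M[F]_(m, n)) : enorm (A + B) <= enorm A + enorm B.
Proof.
rewrite /enorm -big_split; apply: ler_sum => i _ /=.
by rewrite -big_split; apply: ler_sum => j _; rewrite mxE scalar_normD.
Qed.

Lemma enormN m n (A : 'M[F]_(m, n)) : enorm (- A) = enorm A.
Proof. by apply: eq_bigr => i _; apply: eq_bigr => j _; rewrite mxE normrN. Qed.

Lemma enormZ m n r (A : 'M[F]_(m, n)) : 0 <= r -> enorm (emb r *: A) = r * enorm A.
Proof.
move=> r0; rewrite mulr_sumr; apply: eq_bigr => i _; rewrite mulr_sumr.
by apply: eq_bigr => j _; rewrite mxE scalar_norm_embM.
Qed.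

Lemma enorm_adj m n (A : 'M[F]_(m, n)) : enorm (adj A) = enorm A.
Proof.
rewrite /enorm exchange_big; apply: eq_bigr => i _; apply: eq_bigr => j _.
by rewrite adjmxE scalar_norm_conj.
Qed.

Lemma enormM m n p (A : 'M[F]_(m, n)) (B : 'M[F]_(n, p)) :
  enorm (A *m B) <= enorm A * enorm B.
Proof.
rewrite mulr_suml; apply: ler_sum => i _; rewrite mulr_suml.
apply: (@le_trans _ _ (\sum_k \sum_j re `|A i j| * re `|B j k|)).
  apply: ler_sum => k _; rewrite mxE; apply: le_trans (scalar_norm_sum _ _ _) _.
  by apply: ler_sum => j _; rewrite scalar_normM.
rewrite exchange_big; apply: ler_sum => j _ /=; rewrite -mulr_sumr.
apply: ler_wpM2l; first exact: scalar_norm_ge0.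
rewrite /enorm (bigD1 j) //= lerDl.
by do 2!apply: sumr_ge0 => ? _; exact: scalar_norm_ge0.
Qed.

Lemma enorm_cong m n (P : 'M[F]_(m, n)) (A : 'M[F]_n) :
  enorm (P *m A *m adj P) <= enorm P ^+ 2 * enorm A.
Proof.
apply: le_trans (enormM _ _) _; rewrite enorm_adj expr2 -mulrA mulrC.
by apply: ler_wpM2l; [exact: enorm_ge0|exact: enormM].
Qed.

Lemma re_trace_le_enorm n (A : 'M[F]_n) : re (\tr A) <= enorm A.
Proof.
rewrite scalar_re_sum; apply: ler_sum => i _; apply: le_trans (scalar_re_le_norm _) _.
by rewrite (bigD1 i) //= lerDl; apply: sumr_ge0 => ? _; exact: scalar_norm_ge0.
Qed.

Lemma re_trace_mul_adj m n (A : 'M[F]_(m, n)) :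
  re (\tr (A *m adj A)) = \sum_i \sum_j re `|A i j| ^+ 2.
Proof.
rewrite scalar_re_sum; apply: eq_bigr => i _; rewrite mxE scalar_re_sum.
by apply: eq_bigr => j _; rewrite adjmxE scalar_mul_conj scalar_re_emb.
Qed.

(** Cauchy-Schwarz against the all-ones vector, by summing $a_ia_j\le(a_i^2+a_j^2)/2$ over all
    pairs. *)
Lemma sqr_sum_le n (a : 'I_n -> R) : (\sum_i a i) ^+ 2 <= n%:R * \sum_i a i ^+ 2.
Proof.
have -> : n%:R * \sum_i a i ^+ 2 = \sum_i \sum_j (a i ^+ 2 + a j ^+ 2) / 2.
  under [RHS]eq_bigr do rewrite -mulr_suml big_split sumr_const card_ord.
  rewrite -mulr_suml big_split sumr_const card_ord /= sumrMnl -mulr_natl.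
  by field.
rewrite expr2 mulr_suml; apply: ler_sum => i _; rewrite mulr_sumr.
by apply: ler_sum => j _; have := sqr_ge0 (a i - a j); rewrite sqrrB -subr_ge0; lra.
Qed.

Lemma enorm_sqr_le n (x : 'cV[F]_n) : enorm x ^+ 2 <= n%:R * re (\tr (x *m adj x)).
Proof.
rewrite -l1normE re_trace_mul_adj; apply: le_trans (sqr_sum_le _) _.
by under [X in _ <= _ * X]eq_bigr do rewrite big_ord1.
Qed.
End EntryNorm.

(** * Rank-one decompositions of positive semidefinite matrices *)

Section OuterSums.
Context (R : realType) (K : scalar_kind) (n : nat).
Local Notation F := (scalar_field R K).
Local Notation conj := (scalar_conj R K).
Local Notation re := (@scalar_re R K).
Local Notation emb := (scalar_emb R K).
Local Notation adj := (@adjmx R K _ _).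
Local Notation psd := (@psd R K n).
Implicit Types (A B : 'M[F]_n) (x : 'cV[F]_n) (s : seq 'cV[F]_n).

(** Lists replace families over ['I_N]: decompositions are then added by concatenation, and scaled
    or compressed by [map]. [gamma_plusE] translates back. *)
Definition outer_sum s : 'M[F]_n := \sum_(x <- s) x *m adj x.
Definition l1sq_sum s : R := \sum_(x <- s) l1norm x ^+ 2.

Lemma l1sq_sum_ge0 s : 0 <= l1sq_sum s.
Proof. by apply: sumr_ge0 => x _; exact: sqr_ge0. Qed.

Lemma outer_sum_cat s1 s2 : outer_sum (s1 ++ s2) = outer_sum s1 + outer_sum s2.
Proof. exact: big_cat. Qed.

Lemma l1sq_sum_cat s1 s2 : l1sq_sum (s1 ++ s2) = l1sq_sum s1 + l1sq_sum s2.
Proof. exact: big_cat. Qed.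

Lemma outer_sumZ (r : R) s : 0 <= r -> exists2 s',
  outer_sum s' = emb r *: outer_sum s & l1sq_sum s' = r * l1sq_sum s.
Proof.
move=> r0; exists [seq emb (Num.sqrt r) *: x | x <- s].
  rewrite /outer_sum big_map scaler_sumr; apply: eq_bigr => x _.
  by rewrite adjmxZ -scalemxAl -scalemxAr scalerA -rmorphM -expr2 sqr_sqrtr.
rewrite /l1sq_sum big_map mulr_sumr; apply: eq_bigr => x _.
by rewrite !l1normE enormZ ?sqrtr_ge0 // exprMn sqr_sqrtr.
Qed.

Lemma outer_sum_map (P : 'M[F]_n) s :
  outer_sum [seq P *m x | x <- s] = P *m outer_sum s *m adj P.
Proof.
rewrite /outer_sum big_map mulmx_sumr mulmx_suml; apply: eq_bigr => x _.
by rewrite adjmxM !mulmxA.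
Qed.

Lemma l1sq_sum_le_trace s : l1sq_sum s <= n%:R * re (\tr (outer_sum s)).
Proof.
rewrite raddf_sum scalar_re_sum mulr_sumr; apply: ler_sum => x _.
by rewrite l1normE; exact: enorm_sqr_le.
Qed.

(** The columns of L are the vectors of s. *)
Lemma outer_sum_factor s : exists m (L : 'M[F]_(n, m)), outer_sum s = L *m adj L.
Proof.
elim: s => [|x s [m [L LE]]].
  by exists 0%N, 0; rewrite /outer_sum big_nil mul0mx.
exists (1 + m)%N, (row_mx x L).
rewrite /outer_sum big_cons -/(outer_sum s) LE.
by rewrite {3}/adjmx tr_row_mx map_col_mx mul_row_col.
Qed.

Lemma selfadjP A : selfadj A <-> adj A = A.
Proof.
rewrite /selfadj /= is_hermitianmxE expr0 scale1r.
by split=> [/eqP/esym|/esym/eqP].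
Qed.

Lemma qform_trace A x : qform A x = re (\tr (A *m (x *m adj x))).
Proof. by rewrite mulmxA mxtrace_mulC mulmxA /mxtrace big_ord1. Qed.

Lemma re_trace_outer_sum A s : re (\tr (A *m outer_sum s)) = \sum_(x <- s) qform A x.
Proof.
rewrite mulmx_sumr raddf_sum scalar_re_sum; apply: eq_bigr => x _.
by rewrite qform_trace.
Qed.

Lemma qformD A B x : qform (A + B) x = qform A x + qform B x.
Proof. by rewrite /qform mulmxDr mulmxDl mxE scalar_reD. Qed.

Lemma qformN A x : qform (- A) x = - qform A x.
Proof. by rewrite /qform mulmxN mulNmx mxE scalar_reN. Qed.

Lemma qformZ r A x : qform (emb r *: A) x = r * qform A x.
Proof. by rewrite /qform -scalemxAr -scalemxAl mxE scalar_reM_emb. Qed.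

Lemma qform_cong (P : 'M[F]_n) A x : qform (P *m A *m adj P) x = qform A (adj P *m x).
Proof. by rewrite /qform adjmxM adjmxK !mulmxA. Qed.

Lemma qform_le_enorm A x : qform A x <= enorm x ^+ 2 * enorm A.
Proof.
rewrite qform_trace; apply: le_trans (re_trace_le_enorm _) _.
apply: le_trans (enormM _ _) _; rewrite mulrC.
apply: ler_wpM2r; first exact: enorm_ge0.
by rewrite expr2 -{2}(enorm_adj x); exact: enormM.
Qed.

Lemma psd_cong (P : 'M[F]_n) A : psd A -> psd (P *m A *m adj P).
Proof.
move=> [/selfadjP A1 A2]; split; last by move=> x; rewrite qform_cong.
by apply/selfadjP; rewrite !adjmxM adjmxK A1 mulmxA.
Qed.

Lemma psd_outer_sum s : psd (outer_sum s).
Proof.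
split=> [|x].
  apply/selfadjP; rewrite (big_morph _ (@adjmxD _ _ _ _) (@adjmx0 _ _ _ _)).
  by apply: eq_bigr => x _; rewrite adjmxM adjmxK.
rewrite /qform mulmx_sumr mulmx_suml summxE scalar_re_sum.
apply: sumr_ge0 => y _.
have -> : adj x *m (y *m adj y) *m x = adj x *m y *m adj (adj x *m y).
  by rewrite adjmxM adjmxK !mulmxA.
set M := adj x *m y; have -> : (M *m adj M) 0 0 = \tr (M *m adj M).
  by rewrite /mxtrace big_ord1.
by rewrite re_trace_mul_adj; do 2!apply: sumr_ge0 => ? _; exact: sqr_ge0.
Qed.

Lemma delta_mulmx A (i j : 'I_n) :
  (adj (delta_mx i 0 : 'cV[F]_n) *m A *m (delta_mx j 0 : 'cV[F]_n)) 0 0 = A i j.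
Proof.
have -> : adj (delta_mx i 0 : 'cV[F]_n) = delta_mx 0 i.
  by apply/matrixP => k l; rewrite adjmxE !mxE rmorph_nat andbC.
by rewrite -rowE -colE !mxE.
Qed.

Lemma psd_diag A i : psd A -> A i i = emb (re (A i i)) /\ 0 <= re (A i i).
Proof.
move=> [/selfadjP A1 A2]; split.
  by apply: scalar_conj_fixed; rewrite -adjmxE A1.
by have := A2 (delta_mx i 0); rewrite /qform delta_mulmx.
Qed.

Lemma psd_diag0 A : psd A -> (forall i, A i i = 0) -> A = 0.
Proof.
move=> pA A0; have [/selfadjP A1 A2] := pA; apply/matrixP => i j; rewrite mxE.
have Aji : A j i = conj (A i j) by rewrite -adjmxE A1.
pose x : 'cV[F]_n := delta_mx i 0; pose y : 'cV[F]_n := delta_mx j 0.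
(* With zero diagonal, the form at $e_i-\overline{A_{ij}}e_j$ equals $-2|A_{ij}|^2$, so its
   nonnegativity forces $A_{ij}=0$. *)
have := A2 (x - conj (A i j) *: y); rewrite /qform.
have -> : adj (x - conj (A i j) *: y) = adj x - A i j *: adj y.
  rewrite adjmxD adjmxN; congr (_ - _); apply/matrixP => k l.
  by rewrite !(adjmxE, mxE) rmorphM scalar_conjK.
rewrite !(mulmxBl, mulmxBr) -!(scalemxAl, scalemxAr).
move: (delta_mulmx A i i) (delta_mulmx A i j) (delta_mulmx A j i) (delta_mulmx A j j).
rewrite -/x -/y; move: (adj x *m A *m x) (adj x *m A *m y) => xx xy.
move: (adj y *m A *m x) (adj y *m A *m y) => yx yy Exx Exy Eyx Eyy.
rewrite !mxE Exx Exy Eyx Eyy !A0 Aji !mulr0 subr0 sub0r [conj _ * _]mulrC -opprD.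
rewrite scalar_mul_conj -rmorphD -rmorphN scalar_re_emb oppr_ge0 -mulr2n pmulrn_lle0 //.
rewrite real_exprn_even_le0 ?num_real //= scalar_norm_eq0.
by move/eqP.
Qed.

(* Peeling off the rank-one part (A e_i)(A e_i)^* / A_ii of a psd matrix leaves
   a psd matrix with one more zero on the diagonal. *)
Lemma psd_outer_sumP A : psd A -> exists s, A = outer_sum s.
Proof.
have [k] := ubnP #|[pred i | A i i != 0]|; elim: k A => // k IH A Ak pA.
have [A0|/existsNP[i /eqP Ai]] := pselect (forall i, A i i = 0).
  by exists [::]; rewrite (psd_diag0 pA A0) /outer_sum big_nil.
have [Aii Aii0] := psd_diag i pA; set a := re (A i i) in Aii Aii0.
have a0 : 0 < a.
  by rewrite lt_def Aii0 andbT; apply: contra_neq Ai => a0; rewrite Aii a0 rmorph0.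
pose e : 'cV[F]_n := delta_mx i 0; pose u := A *m e.
(* The remainder $A-a^{-1}uu^*$ equals the congruence $PAP^*$, hence is psd. *)
pose P := 1%:M - emb a^-1 *: (u *m adj e).
have uE : adj u = adj e *m A.
  by rewrite adjmxM; have [/selfadjP -> _] := pA.
have eAe : adj e *m A *m e = (emb a)%:M.
  by apply/matrixP => k' l; rewrite !ord1 delta_mulmx Aii mxE.
have PE : P *m A *m adj P = A - emb a^-1 *: (u *m adj u).
  rewrite adjmxD adjmxN adjmxZ adjmx1 adjmxM adjmxK uE.
  rewrite /P mulmxBl mul1mx mulmxBr mulmx1 mulmxBl.
  rewrite -!(scalemxAl, scalemxAr) -[u *m adj e *m A]mulmxA mulmxA -/u.
  set W := u *m adj e *m A.
  have -> : A *m (e *m (adj e *m A)) = W by rewrite mulmxA -/u mulmxA.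
  have -> : W *m (e *m (adj e *m A)) = emb a *: W.
    rewrite /W -[u *m adj e *m A]mulmxA -[LHS]mulmxA [X in u *m X]mulmxA eAe.
    by rewrite mul_scalar_mx -scalemxAr.
  rewrite [emb a^-1 *: (emb a *: W)]scalerA -rmorphM mulVf ?gt_eqF //.
  by rewrite rmorph1 scale1r subrr subr0.
have := psd_cong P pA; rewrite PE; set A' := A - _ => pA'.
have A'E j : A' j j = A j j - emb (a^-1 * re `|A j i| ^+ 2).
  have uj : u j 0 = A j i by rewrite /u -colE mxE.
  rewrite /A' mxE [X in _ + X]mxE [X in - X]mxE [X in _ * X]mxE big_ord1 adjmxE uj.
  by rewrite scalar_mul_conj -rmorphM.
have card_lt : (#|[pred i | A' i i != 0%R]| < k)%N.
  rewrite ltnS in Ak; apply: leq_trans Ak.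
  apply/proper_card/properP; split; last first.
    exists i; first by rewrite inE.
    rewrite inE negbK A'E Aii ger0_norm ?scalar_emb_ge0 // scalar_re_emb.
    by rewrite expr2 mulKf ?subrr //; exact: lt0r_neq0.
  (* A zero diagonal entry stays zero: its new value is minus a square over a, yet nonnegative
     because A' is psd. *)
  apply/fintype.subsetP => j; rewrite !inE; apply: contra_neq => Ajj.
  have [] := psd_diag j pA'; rewrite A'E Ajj sub0r -rmorphN scalar_re_emb.
  move=> _ le0; rewrite -(rmorph0 emb); congr (emb _).
  by apply/le_anti; rewrite le0 andbT oppr_le0 mulr_ge0 ?sqr_ge0 // invr_ge0.
have [s A's] := IH _ card_lt pA'.
have [s' s'E _] := @outer_sumZ a^-1 [:: u] (ltac:(by rewrite invr_ge0)).
exists (s' ++ s); rewrite outer_sum_cat -A's s'E /outer_sum big_seq1.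
by rewrite addrC subrK.
Qed.
End OuterSums.

(** * Hahn-Banach for sublinear functionals on a real vector space *)

Section HahnBanach.
Context (R : realType) (V : lmodType R).
Implicit Types (p : V -> R) (u v a : V).

Definition sublinear p :=
  (forall u v, p (u + v) <= p u + p v) /\
  (forall (r : R) v, 0 <= r -> p (r *: v) <= r * p v).

Lemma sublinear0 p : sublinear p -> p 0 = 0.
Proof.
move=> [pD pZ]; apply/eqP; rewrite eq_le.
have := pZ 0 0 (lexx _); rewrite scale0r mul0r => ->.
by have := pD 0 0; rewrite addr0 -subr_ge0 addrK.
Qed.

Lemma sublinearN p v : sublinear p -> - p (- v) <= p v.
Proof. by move=> sp; have := sp.1 v (- v); rewrite subrr sublinear0 // => ?; lra. Qed.

Lemma sublinearZ p (r : R) v : sublinear p -> 0 <= r -> p (r *: v) = r * p v.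
Proof.
move=> sp; rewrite le_eqVlt => /predU1P[<-|r0].
  by rewrite scale0r mul0r sublinear0.
apply/le_anti; rewrite sp.2 ?(ltW r0)//=.
have : p (r^-1 *: (r *: v)) <= r^-1 * p (r *: v) by rewrite sp.2 ?invr_ge0 ?ltW.
by rewrite scalerA mulVf ?gt_eqF // scale1r ler_pdivlMl.
Qed.

Lemma inf_le (S : set R) (x m : R) : lbound S m -> S x -> inf S <= x.
Proof. by move=> Sm Sx; apply: ge_inf => //; exists m. Qed.

(* Infimal convolution of p with the linear functional t a |-> t p(a) on the
   half-line spanned by a: the largest sublinear minorant of p which is odd at a. *)
Lemma sublinear_odd_at p a : sublinear p ->
  exists q, [/\ sublinear q, forall v, q v <= p v & q (- a) <= - p a].
Proof.
move=> sp.
pose S v := [set s | exists2 t : R, 0 <= t & s = p (v + t *: a) - t * p a].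
have Slb v : lbound (S v) (- p (- v)).
  (* Subadditivity on $ta=(v+ta)+(-v)$ keeps the infimum finite. *)
  move=> _ [t t0 ->]; rewrite -sublinearZ //.
  by have := sp.1 (v + t *: a) (- v); rewrite addrAC subrr add0r => ?; lra.
have S0 v : S v !=set0 by exists (p (v + 0 *: a) - 0 * p a), 0.
have qle v (t : R) : 0 <= t -> inf (S v) <= p (v + t *: a) - t * p a.
  by move=> t0; apply: inf_le (Slb v) _; exists t.
exists (fun v => inf (S v)); split; last 2 first.
- by move=> v; have := qle v 0 (lexx _); rewrite scale0r mul0r addr0 subr0.
- have := qle (- a) 1 ler01.
  by rewrite scale1r mul1r addNr sublinear0 // sub0r.
split=> [u v|r v r0].
  rewrite -lerBlDr; apply: lb_le_inf => // _ [t t0 ->]; rewrite lerBlDr -lerBlDl.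
  apply: lb_le_inf => // _ [s s0 ->]; rewrite lerBlDl.
  apply: le_trans (qle _ (t + s) (addr_ge0 t0 s0)) _.
  rewrite scalerDl addrACA; have := sp.1 (u + t *: a) (v + s *: a); lra.
move: r0; rewrite le_eqVlt => /predU1P[<-|r0].
  apply: le_trans (qle _ 0 (lexx _)) _.
  by rewrite !scale0r !mul0r subr0 addr0 sublinear0.
rewrite -ler_pdivrMl //; apply: lb_le_inf => // _ [t t0 ->].
rewrite ler_pdivrMl //; apply: le_trans (qle _ (r * t) _) _.
  exact: mulr_ge0 (ltW r0) t0.
by rewrite -scalerA -scalerDr (sublinearZ _ sp (ltW r0)) mulrBr mulrA.
Qed.

(** A minimal sublinear functional is linear, as [sublinear_odd_at] would otherwise lower it. Zorn's
    lemma is applied below a minorant [p1] with $p_1(-a)\le-p(a)$, which forces $f(a)=p(a)$. *)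
Theorem hahn_banach p a : sublinear p -> exists f : V -> R,
  [/\ {morph f : u v / u + v}, forall (r : R) v, f (r *: v) = r * f v,
      forall v, f v <= p v & f a = p a].
Proof.
move=> sp; have [p1 [sp1 p1p p1a]] := sublinear_odd_at a sp.
pose T := {q : V -> R | sublinear q /\ forall v, q v <= p1 v}.
(* The order is reversed, so a maximal element is pointwise minimal. *)
pose ler (q1 q2 : T) := `[< forall v, sval q2 v <= sval q1 v >].
pose p1T : T := exist _ p1 (conj sp1 (fun=> lexx _)).
have [||C Ctot|[q [sq qp1]] qmin] := @ZL_preorder T p1T ler.
- by move=> q; apply/asboolP.
- move=> q1 q2 q3 /asboolP le1 /asboolP le2; apply/asboolP => v.
  exact: le_trans (le2 v) (le1 v).
- have [[q0 Cq0]|C0] := pselect (exists q0, C q0); last first.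
    by exists p1T => q Cq; case: C0; exists q.
  pose S v := [set s | exists2 q : T, C q & s = sval q v].
  have Slb v : lbound (S v) (- p1 (- v)).
    move=> _ [[q [sq qp]] _ ->] /=; apply: le_trans (sublinearN _ sq).
    by rewrite lerN2.
  have S0 v : S v !=set0 by exists (sval q0 v), q0.
  have infle q v : C q -> inf (S v) <= sval q v.
    by move=> Cq; apply: inf_le (Slb v) _; exists q.
  have sinf : sublinear (fun v => inf (S v)).
    split=> [u v|r v r0].
      rewrite -lerBlDr; apply: lb_le_inf => // _ [q1 C1 ->]; rewrite lerBlDr -lerBlDl.
      apply: lb_le_inf => // _ [q2 C2 ->]; rewrite lerBlDl.
      (* The infimum over a chain is subadditive: of two members, the smaller one serves for both
         arguments. *)
      case: (Ctot _ _ C1 C2) => /asboolP le12.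
        apply: le_trans (infle _ _ C2) _.
        by apply: le_trans ((svalP q2).1.1 u v) _; rewrite lerD2r le12.
      apply: le_trans (infle _ _ C1) _.
      by apply: le_trans ((svalP q1).1.1 u v) _; rewrite lerD2l le12.
    move: r0; rewrite le_eqVlt => /predU1P[<-|r0].
      rewrite scale0r mul0r; apply: le_trans (infle _ _ Cq0) _.
      by rewrite sublinear0 //; exact: (svalP q0).1.
    rewrite -ler_pdivrMl //; apply: lb_le_inf => // _ [q1 C1 ->].
    rewrite ler_pdivrMl //; apply: le_trans (infle _ _ C1) _.
    by apply: (svalP q1).1.2; exact: ltW.
  have infp1 v : inf (S v) <= p1 v.
    by apply: le_trans (infle _ v Cq0) _; exact: (svalP q0).2.
  exists (exist _ (fun v => inf (S v)) (conj sinf infp1) : T) => q Cq.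
  by apply/asboolP => v /=; exact: infle.
have qN v : q (- v) = - q v.
  apply/le_anti; rewrite lerNl sublinearN // andbT.
  (* By minimality $q\le q'$, so $q(-v)\le q'(-v)\le-q(v)$. *)
  have [q' [sq' q'q q'v]] := sublinear_odd_at v sq.
  have q'p1 u : q' u <= p1 u by exact: le_trans (q'q u) (qp1 u).
  have /asboolP/(_ (- v)) /= := qmin (exist _ q' (conj sq' q'p1)) (asboolT q'q).
  by move=> /le_trans; apply.
exists q; split.
- move=> u v; apply/le_anti; rewrite sq.1 /=.
  by have := sq.1 (- u) (- v); rewrite -opprD !qN; lra.
- move=> r v; have [r0|r0] := leP 0 r; first exact: sublinearZ.
  by rewrite -[r]opprK scaleNr qN sublinearZ ?mulNr // oppr_ge0 ltW.
- by move=> v; exact: le_trans (qp1 v) (p1p v).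
- apply/le_anti; rewrite (le_trans (qp1 a) (p1p a)) /=.
  rewrite -lerN2 -qN; exact: le_trans (qp1 _) p1a.
Qed.
End HahnBanach.

(** * Quantitative lower semicontinuity of the gauge *)

Section LowerSemicontinuity.
Context (R : realType) (K : scalar_kind) (n : nat).
Local Notation F := (scalar_field R K).
Local Notation re := (@scalar_re R K).
Local Notation emb := (scalar_emb R K).
Local Notation adj := (@adjmx R K _ _).
Local Notation psd := (@psd R K n).
Implicit Types (A B : 'M[F]_n) (x : 'cV[F]_n) (s : seq 'cV[F]_n).

(** Write $Px=x-(1-P)x$ and use $(a+b)^2\le(1+\varepsilon)a^2+(1+\varepsilon^{-1})b^2$. *)
Lemma l1sq_sum_map (P : 'M[F]_n) (eps : R) s : 0 < eps ->
  l1sq_sum [seq P *m x | x <- s] <=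
  (1 + eps) * l1sq_sum s + (1 + eps^-1) * l1sq_sum [seq (1%:M - P) *m x | x <- s].
Proof.
move=> e0; rewrite /l1sq_sum !big_map !mulr_sumr -big_split /=.
apply: ler_sum => x _; rewrite !l1normE.
have le_add : enorm (P *m x) <= enorm x + enorm ((1%:M - P) *m x).
  rewrite -[X in _ <= _ + X]enormN; apply: le_trans (enormD _ _).
  by rewrite mulmxBl mul1mx opprB addrC subrK.
apply: (@le_trans _ _ ((enorm x + enorm ((1%:M - P) *m x)) ^+ 2)).
  by rewrite ler_sqr ?nnegrE ?addr_ge0 ?enorm_ge0.
set a := enorm x; set b := enorm _; rewrite -subr_ge0.
have -> : (1 + eps) * a ^+ 2 + (1 + eps^-1) * b ^+ 2 - (a + b) ^+ 2 =
    eps^-1 * (eps * a - b) ^+ 2 by field; exact: lt0r_neq0.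
by rewrite mulr_ge0 ?sqr_ge0 // invr_ge0 ltW.
Qed.

(* Lower semicontinuity of the gauge gamma_+ at A, in quantitative form. Write
   A = L L^* and let P = L L^+ with L L^+ L = L, so that P A P^* = A.  For any
   B = sum x x^* with |A - B| = d, the matrix (1 + c d) A - P B P^* is psd and
   O(d), while sum |(1 - P) x|^2 is O(|(1 - P)(B - A)(1 - P)^*|) = O(d). *)
Lemma gauge_lower_bound A (eps g : R) : psd A -> 0 < eps ->
    (forall s, A = outer_sum s -> g <= l1sq_sum s) ->
  exists2 M : R, 0 <= M &
    forall s, g <= (1 + eps) * l1sq_sum s + M * enorm (A - outer_sum s).
Proof.
move=> pA e0 gP; have [s0 As0] := psd_outer_sumP pA.
have [m [L]] := outer_sum_factor s0; rewrite -As0 => AL.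
pose Q := pinvmx L; pose P := L *m Q.
have PL : P *m L = L by exact: mulmxKpV.
have PA : P *m A = A by rewrite AL mulmxA PL.
have Asym : adj A = A by case: pA => /selfadjP.
have AP : A *m adj P = A by rewrite -{1}Asym -adjmxM PA.
(* Chosen for $\|P^*v\|_1^2\le c\langle Av,v\rangle$: $P^*=Q^*L^*$, $\langle
   Av,v\rangle=\|L^*v\|_2^2$, and m is the cost of passing from l1 to l2. *)
pose c := m%:R * enorm (adj Q) ^+ 2.
have c0 : 0 <= c by rewrite mulr_ge0 ?sqr_ge0.
(* The first summand pays for a decomposition of the correction [C], the second for the vectors
   $(1-P)x$. *)
exists (n%:R * (enorm P ^+ 2 + c * enorm A)
        + (1 + eps^-1) * (n%:R * enorm (1%:M - P) ^+ 2)).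
  rewrite addr_ge0 ?mulr_ge0 ?addr_ge0 ?sqr_ge0 ?mulr_ge0 ?enorm_ge0 //.
  by rewrite invr_ge0 ltW.
move=> s; set B := outer_sum s; set d := enorm (A - B).
have d0 : 0 <= d by exact: enorm_ge0.
have Bsym : adj B = B by case: (psd_outer_sum s) => /selfadjP.
have wle v : enorm (adj P *m v) ^+ 2 <= c * qform A v.
  have -> : qform A v = re (\tr ((adj L *m v) *m adj (adj L *m v))).
    by rewrite mxtrace_mulC adjmxM adjmxK /mxtrace big_ord1 /qform AL !mulmxA.
  rewrite [adj P]adjmxM -[adj Q *m adj L *m v]mulmxA.
  apply: (@le_trans _ _ (enorm (adj Q) ^+ 2 * enorm (adj L *m v) ^+ 2)).
    rewrite -exprMn; apply: lerXn2r; last exact: enormM.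
      by rewrite nnegrE enorm_ge0.
    by rewrite nnegrE mulr_ge0 ?enorm_ge0.
  rewrite [leRHS]mulrAC [leRHS]mulrC.
  by apply: ler_wpM2l; [exact: sqr_ge0|exact: enorm_sqr_le].
pose C := P *m (A - B) *m adj P + emb (c * d) *: A.
have cd0 : 0 <= c * d by rewrite mulr_ge0.
have pC : psd C.
  split=> [|v].
    apply/selfadjP; rewrite /C adjmxD adjmxZ [adj (_ *m adj P)]adjmxM.
    rewrite [adj (P *m (A - B))]adjmxM adjmxK [adj (A - B)]adjmxD adjmxN.
    by rewrite Asym Bsym mulmxA.
  rewrite /C qformD qformZ qform_cong -[A - B]opprK qformN.
  rewrite addrC subr_ge0; apply: le_trans (qform_le_enorm _ _) _.
  by rewrite enormN -/d [leRHS]mulrAC; apply: ler_wpM2r.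
have [t Ct] := psd_outer_sumP pC.
have t_le : l1sq_sum t <= n%:R * (enorm P ^+ 2 + c * enorm A) * d.
  apply: le_trans (l1sq_sum_le_trace _) _; rewrite -Ct -mulrA.
  apply: ler_wpM2l => //; apply: le_trans (re_trace_le_enorm _) _.
  apply: le_trans (enormD _ _) _; rewrite enormZ // mulrDl [c * _ * d]mulrAC lerD2r.
  exact: enorm_cong.
have y_le : l1sq_sum [seq (1%:M - P) *m x | x <- s] <= n%:R * enorm (1%:M - P) ^+ 2 * d.
  apply: le_trans (l1sq_sum_le_trace _) _; rewrite outer_sum_map -mulrA.
  apply: ler_wpM2l => //; apply: le_trans (re_trace_le_enorm _) _.
  (* As $(1-P)A=0$, B may be replaced by $B-A$, of norm d. *)
  have -> : (1%:M - P) *m outer_sum s *m adj (1%:M - P) =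
      (1%:M - P) *m - (A - B) *m adj (1%:M - P).
    by rewrite opprB [in RHS]mulmxBr [(1%:M - P) *m A]mulmxBl mul1mx PA subrr subr0.
  by apply: le_trans (enorm_cong _ _) _; rewrite enormN.
have cd1 : 0 < 1 + c * d by rewrite ltr_pwDl.
(* $PBP^*+C=(1+cd)A$, so rescaling yields an exact decomposition of A, to which the hypothesis on g
   applies. *)
have [s' s'A s'l] : exists2 s', outer_sum s' = A & l1sq_sum s' =
    (1 + c * d)^-1 * (l1sq_sum [seq P *m x | x <- s] + l1sq_sum t).
  rewrite -l1sq_sum_cat.
  have [|s' s'E s'l] := @outer_sumZ R K n (1 + c * d)^-1 ([seq P *m x | x <- s] ++ t).
    by rewrite invr_ge0 ltW.
  exists s' => //; rewrite s'E outer_sum_cat outer_sum_map -Ct -/B /C.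
  rewrite mulmxBr mulmxBl PA AP addrA addrCA subrr addr0.
  rewrite -{1}[A]scale1r -(rmorph1 emb) -scalerDl -rmorphD scalerA -rmorphM.
  by rewrite mulVf ?rmorph1 ?scale1r //; exact: lt0r_neq0.
apply: le_trans (gP s' (esym s'A)) _; rewrite s'l ler_pdivrMl //.
set X := (X in _ <= _ * X).
have le_X : l1sq_sum [seq P *m x | x <- s] + l1sq_sum t <= X.
  have e1 : 0 <= 1 + eps^-1 by rewrite addr_ge0 ?invr_ge0 ?ltW.
  have := ler_wpM2l e1 y_le; have := l1sq_sum_map P s e0; rewrite /X.
  by lra.
apply: (le_trans le_X); rewrite mulrDl mul1r lerDl mulr_ge0 //.
by apply: le_trans le_X; rewrite addr_ge0 ?l1sq_sum_ge0.
Qed.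
End LowerSemicontinuity.

(** An alias carrying the scalar action of R through [emb], distinct from the action of F on
    matrices; Hahn-Banach is applied over R. *)
Definition real_mx (R : realType) (K : scalar_kind) (n : nat) : Type :=
  'M[scalar_field R K]_n.

Section RealMatrixSpace.
Context (R : realType) (K : scalar_kind) (n : nat).
Local Notation emb := (scalar_emb R K).
Local Notation V := (real_mx R K n).

HB.instance Definition _ := GRing.Zmodule.copy V 'M[scalar_field R K]_n.

Definition real_mx_scale (r : R) (A : V) : V := emb r *: (A : 'M_n).

Fact real_mx_scalerA a b A :
  real_mx_scale a (real_mx_scale b A) = real_mx_scale (a * b) A.
Proof. by rewrite /real_mx_scale scalerA -rmorphM. Qed.

Fact real_mx_scale1r : left_id 1 real_mx_scale.
Proof. by move=> A; rewrite /real_mx_scale rmorph1 scale1r. Qed.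

Fact real_mx_scalerDr : right_distributive real_mx_scale +%R.
Proof. by move=> r A B; rewrite /real_mx_scale scalerDr. Qed.

Fact real_mx_scalerDl A : {morph real_mx_scale^~ A : a b / a + b}.
Proof. by move=> a b; rewrite /real_mx_scale rmorphD scalerDl. Qed.

HB.instance Definition _ := GRing.Zmodule_isLmodule.Build R V
  real_mx_scalerA real_mx_scale1r real_mx_scalerDr real_mx_scalerDl.
End RealMatrixSpace.

(** * Duality between the gauge and quadratic forms *)

Section Duality.
Context (R : realType) (K : scalar_kind) (n : nat).
Local Notation F := (scalar_field R K).
Local Notation re := (@scalar_re R K).
Local Notation emb := (scalar_emb R K).
Local Notation adj := (@adjmx R K _ _).
Local Notation psd := (@psd R K n).
Implicit Types (A B T : 'M[F]_n) (x : 'cV[F]_n) (s : seq 'cV[F]_n).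

Lemma re_trace_adj A : re (\tr (adj A)) = re (\tr A).
Proof.
rewrite !scalar_re_sum; apply: eq_bigr => i _.
by rewrite adjmxE scalar_re_conj.
Qed.

Lemma mx_riesz (f : 'M[F]_n -> R) : {morph f : A B / A + B} ->
  (forall r A, f (emb r *: A) = r * f A) ->
  exists T, forall A, f A = re (\tr (T *m A)).
Proof.
move=> fD fZ.
have /choice [t tP] : forall kl : 'I_n * 'I_n, exists t : F, forall z,
    f (z *: delta_mx kl.1 kl.2) = re (t * z).
  move=> kl; apply: scalar_riesz => [z w|r z]; first by rewrite scalerDl fD.
  by rewrite -scalerA fZ.
have f0 : f 0 = 0 by rewrite -(scaler0 _ (emb 0)) fZ mul0r.
(* Indices are swapped because $\mathrm{tr}(TA)=\sum_{k,l}T_{lk}A_{kl}$. *)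
exists (\matrix_(l, k) t (k, l)) => A.
rewrite {1}[A]matrix_sum_delta (big_morph f fD f0) scalar_re_sum.
rewrite (eq_bigr (fun k => \sum_l f (A k l *: delta_mx k l))); last first.
  by move=> k _; rewrite (big_morph f fD f0).
rewrite exchange_big; apply: eq_bigr => l _; rewrite mxE scalar_re_sum.
by apply: eq_bigr => k _; rewrite (tP (k, l)) mxE.
Qed.

(** The functional p of the overview, with c for $1+\varepsilon$. The empty list always competes, so
    it is finite on all matrices, including those with no decomposition. *)
Definition regularized_gauge (c M : R) A : R :=
  inf [set s | exists t, s = c * l1sq_sum t + M * enorm (A - outer_sum t)].

Section Regularized.
Variables (c M : R).
Hypotheses (c0 : 0 <= c) (M0 : 0 <= M).

Lemma regularized_gauge_le A s :
  regularized_gauge c M A <= c * l1sq_sum s + M * enorm (A - outer_sum s).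
Proof.
apply: (@inf_le _ _ _ 0); last by exists s.
by move=> _ [t ->]; rewrite addr_ge0 ?mulr_ge0 ?enorm_ge0 ?l1sq_sum_ge0.
Qed.

Lemma le_regularized_gauge A (g : R) :
  (forall s, g <= c * l1sq_sum s + M * enorm (A - outer_sum s)) ->
  g <= regularized_gauge c M A.
Proof.
move=> gle; apply: lb_le_inf; first by eexists; exists [::].
by move=> _ [t ->].
Qed.

Lemma regularized_gauge_sublinear :
  sublinear (regularized_gauge c M : real_mx R K n -> R).
Proof.
split=> [A B|r A].
  rewrite -lerBlDr; apply: le_regularized_gauge => s; rewrite lerBlDr -lerBlDl.
  apply: le_regularized_gauge => t; rewrite lerBlDl.
  apply: le_trans (regularized_gauge_le _ (s ++ t)) _.
  have -> : A + B - outer_sum (s ++ t) = (A - outer_sum s) + (B - outer_sum t).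
    by rewrite outer_sum_cat opprD addrACA.
  have := ler_wpM2l M0 (enormD (A - outer_sum s) (B - outer_sum t)).
  by rewrite l1sq_sum_cat; lra.
rewrite le_eqVlt => /predU1P[<-|r0].
  rewrite mul0r; apply: le_trans (regularized_gauge_le _ [::]) _.
  by rewrite /l1sq_sum /outer_sum !big_nil mulr0 add0r subr0 scale0r enorm0 mulr0.
rewrite -ler_pdivrMl //; apply: le_regularized_gauge => s; rewrite ler_pdivrMl //.
have [s' s'E s'l] := outer_sumZ s (ltW r0).
apply: le_trans (regularized_gauge_le _ s') _.
have -> : r *: A - outer_sum s' = emb r *: ((A : 'M[F]_n) - outer_sum s).
  by rewrite s'E scalerBr.
by rewrite s'l (enormZ _ (ltW r0)) mulrDr [r * (c * _)]mulrCA [r * (M * _)]mulrCA.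
Qed.
End Regularized.

Theorem gauge_duality A (eps g : R) : psd A -> 0 < eps ->
    (forall s, A = outer_sum s -> g <= l1sq_sum s) ->
  exists T, [/\ selfadj T, forall x, qform T x <= (1 + eps) * l1norm x ^+ 2
    & g <= re (\tr (T *m A))].
Proof.
move=> pA e0 gP; have [M M0 MP] := gauge_lower_bound pA e0 gP.
have e1 : 0 <= 1 + eps by rewrite addr_ge0 ?ltW.
have [f [fD fZ fle fA]] :=
  hahn_banach (A : real_mx R K n) (regularized_gauge_sublinear e1 M0).
have [T0 fE] := @mx_riesz f fD fZ.
(* The self-adjoint part represents f on self-adjoint B, where
   $\mathrm{Re}\,\mathrm{tr}(T_0^*B)=\mathrm{Re}\,\mathrm{tr}(T_0B)$. *)
pose T := emb 2^-1 *: (T0 + adj T0).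
have trT B : selfadj B -> re (\tr (T *m B)) = f B.
  move=> /selfadjP BE; rewrite fE -scalemxAl mxtraceZ scalar_reM_emb mulmxDl.
  rewrite mxtraceD scalar_reD -{2}BE -adjmxM re_trace_adj mxtrace_mulC.
  by field.
exists T; split.
- by apply/selfadjP; rewrite adjmxZ adjmxD adjmxK addrC.
- move=> x; rewrite qform_trace trT; last first.
    by apply/selfadjP; rewrite adjmxM adjmxK.
  (* The one-vector list decomposes $xx^*$ exactly, so the penalty vanishes. *)
  apply: le_trans (fle _) _; apply: le_trans (regularized_gauge_le e1 M0 _ [:: x]) _.
  rewrite /l1sq_sum /outer_sum !big_seq1 subrr enorm0.
  by rewrite mulr0 addr0.
- rewrite trT; last by case: pA.
  by rewrite fA; exact: le_regularized_gauge.
Qed.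
End Duality.

(** * Comparison of the two suprema *)

Section GaugeConstants.
Context (R : realType) (K : scalar_kind) (n : nat).
Local Notation F := (scalar_field R K).
Local Notation re := (@scalar_re R K).
Local Notation emb := (scalar_emb R K).
Local Notation psd := (@psd R K n).
Implicit Types (A B T : 'M[F]_n) (x : 'cV[F]_n) (s : seq 'cV[F]_n).

Lemma gamma_plusE A : gamma_plus A =
  ereal_inf [set (l1sq_sum s)%:E | s in [set s | A = outer_sum s]].
Proof.
congr ereal_inf; apply/seteqP; split=> [_ [N [x [-> ->]]]|_ [s -> <-]].
  exists [seq x k | k <- enum 'I_N].
    by rewrite /= /outer_sum big_map big_enum.
  by rewrite /l1sq_sum big_map big_enum.
exists (size s), (tnth (in_tuple s)).
by split; rewrite /outer_sum /l1sq_sum big_tnth.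
Qed.

Lemma gamma_plus_psd A : psd A -> exists g : R,
  [/\ gamma_plus A = g%:E, 0 <= g, forall s, A = outer_sum s -> g <= l1sq_sum s
    & forall h, (forall s, A = outer_sum s -> h <= l1sq_sum s) -> h <= g].
Proof.
move=> /psd_outer_sumP[s0 As0]; rewrite gamma_plusE; set S := [set _ | _ in _].
have lb s : A = outer_sum s -> (ereal_inf S <= (l1sq_sum s)%:E)%E.
  by move=> As; apply: ereal_inf_lbound; exists s.
have glb h : (forall s, A = outer_sum s -> h <= l1sq_sum s) -> (h%:E <= ereal_inf S)%E.
  by move=> hle; apply: le_ereal_inf_tmp => _ [s As <-]; rewrite lee_fin hle.
have inf0 : (0 <= ereal_inf S)%E.
  by apply: glb => s _; exact: l1sq_sum_ge0.
have infE : ereal_inf S = (fine (ereal_inf S))%:E.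
  by rewrite fineK // ge0_fin_numE // (le_lt_trans (lb _ As0)) ?ltry.
exists (fine (ereal_inf S)); split=> //.
- by rewrite fine_ge0.
- by move=> s As; rewrite -lee_fin -infE lb.
- by move=> h hle; rewrite -lee_fin -infE glb.
Qed.

Lemma qform_scale r T x : qform T (emb r *: x) = r ^+ 2 * qform T x.
Proof.
rewrite /qform adjmxZ -!scalemxAl -scalemxAr scalerA -rmorphM mxE.
by rewrite scalar_reM_emb.
Qed.

(** The point $x=0$ gives nonnegativity even for negative T, [qform_le_enorm] gives finiteness, and
    homogeneity removes the constraint $\|x\|_1\le1$. *)
Lemma rho1_fin T : exists r : R, [/\ rho1 T = r%:E, 0 <= r,
    forall x, qform T x <= r * l1norm x ^+ 2
  & forall c, 0 <= c -> (forall x, qform T x <= c * l1norm x ^+ 2) -> r <= c].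
Proof.
have l10 : l1norm (0 : 'cV[F]_n) = 0 by rewrite l1normE enorm0.
have q0 : qform T 0 = 0 by rewrite /qform mulmx0 mxE scalar_re0.
rewrite /rho1; set S := [set _ | _ in _].
have ub x : l1norm x <= 1 -> ((qform T x)%:E <= ereal_sup S)%E.
  by move=> x1; apply: ereal_sup_ubound; exists x.
have lub c : 0 <= c -> (forall x, qform T x <= c * l1norm x ^+ 2) ->
    (ereal_sup S <= c%:E)%E.
  move=> c0 cP; apply: ge_ereal_sup => _ [x x1 <-]; rewrite lee_fin.
  apply: le_trans (cP x) _; rewrite ler_piMr // expr_le1 //.
  by rewrite l1normE enorm_ge0.
have sup0 : (0 <= ereal_sup S)%E by have := ub 0; rewrite q0 l10; exact.
have supE : ereal_sup S = (fine (ereal_sup S))%:E.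
  rewrite fineK // ge0_fin_numE //.
  apply: le_lt_trans (lub _ (enorm_ge0 T) _) (ltry _) => x.
  by rewrite l1normE mulrC; exact: qform_le_enorm.
exists (fine (ereal_sup S)); split=> //.
- by rewrite fine_ge0.
- move=> x; have [->|x0] := eqVneq x 0; first by rewrite q0 l10 expr0n mulr0.
  have lx : 0 < l1norm x by rewrite l1normE enorm_gt0.
  have : qform T (emb (l1norm x)^-1 *: x) <= fine (ereal_sup S).
    rewrite -lee_fin -supE; apply: ub.
    have lxV : 0 <= (l1norm x)^-1 by rewrite invr_ge0 ltW.
    by rewrite l1normE enormZ // -l1normE mulVf // lt0r_neq0.
  by rewrite qform_scale exprVn mulrC ler_pdivrMr // exprn_gt0.
- by move=> c c0 cP; rewrite -lee_fin -supE lub.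
Qed.

Lemma re_trace_outer_sum_le T (r : R) s : (forall x, qform T x <= r * l1norm x ^+ 2) ->
  re (\tr (T *m outer_sum s)) <= r * l1sq_sum s.
Proof.
move=> rP; rewrite re_trace_outer_sum mulr_sumr.
by apply: ler_sum => x _; exact: rP.
Qed.

Lemma psd0 : psd 0.
Proof.
have <- : outer_sum [::] = 0 :> 'M[F]_n by rewrite /outer_sum big_nil.
exact: psd_outer_sum.
Qed.

Lemma pi_plus_ge0 T : (0 <= pi_plus T)%E.
Proof.
apply: ereal_sup_ubound; exists 0; last by rewrite mulmx0 mxtrace0 scalar_re0.
by split; [exact: psd0|rewrite l11normE enorm0].
Qed.

Lemma pi_plus_ge A T : psd A -> A != 0 ->
  ((re (\tr (T *m A)) / l11norm A)%:E <= pi_plus T)%E.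
Proof.
move=> pA A0; have lA : 0 < l11norm A by rewrite l11normE enorm_gt0.
have [s As] := psd_outer_sumP pA.
have Ai0 : 0 <= (l11norm A)^-1 by rewrite invr_ge0 ltW.
apply: ereal_sup_ubound; exists (emb (l11norm A)^-1 *: A); last first.
  by rewrite -scalemxAr mxtraceZ scalar_reM_emb mulrC.
split.
  have [s' s'E _] := outer_sumZ s Ai0.
  by rewrite {2}As -s'E; exact: psd_outer_sum.
by rewrite /= l11normE (enormZ _ Ai0) -l11normE mulVf // lt0r_neq0.
Qed.

(** A nonzero T excludes $n=0$, where both suprema are over the empty set; then $e_je_j^*$ serves.
    Used to see that $C_n\ge0$. *)
Lemma psd_neq0_exists T : T != 0 -> exists2 A, psd A & A != 0.
Proof.
move=> T0; have [j] : exists j : 'I_n, True.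
  apply: contrapT => noj; move/eqP: T0; apply.
  by apply/matrixP => i; case: noj; exists i.
move=> _; exists (outer_sum [:: delta_mx j 0]); first exact: psd_outer_sum.
apply/eqP => /matrixP/(_ j j)/eqP; rewrite /outer_sum big_seq1 !mxE big_ord1.
by rewrite adjmxE !mxE !eqxx /= mulr1n rmorph1 mulr1 oner_eq0.
Qed.

(** The T of [gauge_duality] has $\rho_1(T)\le1+\varepsilon$, whence
    $\gamma_+(A)\le\mathrm{tr}(TA)\le(1+\varepsilon)S\|A\|_{1,1}$. *)
Lemma ratio_gamma_le_sup A : psd A -> A != 0 ->
  (gamma_plus A / (l11norm A)%:E <=
   ereal_sup [set (pi_plus T / rho1 T)%E | T in @selfadj R K n `\ (0%R : 'M[F]_n)])%E.
Proof.
move=> pA A0; set S := ereal_sup _.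
have lA : 0 < l11norm A by rewrite l11normE enorm_gt0.
have SP T : selfadj T -> T != 0 -> (pi_plus T / rho1 T <= S)%E.
  by move=> sT T0; apply: ereal_sup_ubound; exists T => //; split => //; apply/eqP.
have S0 : (0 <= S)%E.
  have [sA _] := pA; apply: le_trans (SP _ sA A0).
  have [r [-> r0 _ _]] := rho1_fin A.
  by rewrite mule_ge0 ?pi_plus_ge0 // inve_ge0 lee_fin.
have [g [-> g0 gP _]] := gamma_plus_psd pA.
have [s0 As0] := psd_outer_sumP pA.
rewrite inver gt_eqF //.
case: S S0 SP => [S| |] S0 SP; rewrite ?leey //.
rewrite lee_fin in S0.
rewrite -EFinM lee_fin ler_pdivrMr //; apply/ler_addgt0Pr => e e0.
pose X := S * l11norm A; have X0 : 0 <= X by rewrite mulr_ge0 // ltW.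
have X1 : 0 < X + 1 by rewrite ltr_wpDl.
(* This $\varepsilon$ gives $\varepsilon X\le e$; adding 1 covers $X=0$. *)
have eps0 : 0 < e / (X + 1) by rewrite divr_gt0.
have [T [sT Tq gT]] := gauge_duality pA eps0 gP.
apply: (@le_trans _ _ ((1 + e / (X + 1)) * X)); last first.
  rewrite mulrDl mul1r lerD2l mulrAC ler_pdivrMr // ler_wpM2l ?ltW //.
  by rewrite ltrDl.
apply: le_trans gT _.
have [->|T0] := eqVneq T 0.
  by rewrite mul0mx mxtrace0 scalar_re0 mulr_ge0 // addr_ge0 // ltW.
have := SP T sT T0; have := pi_plus_ge T pA A0.
have [r [-> r0 rP r_le]] := rho1_fin T.
(* If $\rho_1(T)=0$, the form of T is nowhere positive, so $\mathrm{tr}(TA)\le0$ without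
   dividing. *)
move: r0; rewrite le_eqVlt => /predU1P[r0|r0] pi_ge.
  move=> _; apply: (@le_trans _ _ 0); last by rewrite mulr_ge0 // addr_ge0 // ltW.
  by rewrite {1}As0 -(mul0r (l1sq_sum s0)); apply: re_trace_outer_sum_le => //; rewrite r0.
rewrite inver gt_eqF // lee_pdivrMr // => /(le_trans pi_ge).
rewrite -EFinM lee_fin ler_pdivrMr // => /le_trans; apply.
rewrite mulrAC mulrC; apply: ler_wpM2r => //.
by apply: r_le => //; rewrite addr_ge0 // ltW.
Qed.

(** Each decomposition of A gives $\mathrm{tr}(TA)\le\rho_1(T)\sum_k\|x_k\|_1^2$; take the infimum,
    then the supremum over A. *)
Lemma ratio_pi_le_gamma_const T : selfadj T -> T != 0 ->
  (pi_plus T / rho1 T <= gamma_const R K n)%E.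
Proof.
move=> sT T0; set C := gamma_const R K n.
have CP A g : psd A -> A != 0 -> gamma_plus A = g%:E -> ((g / l11norm A)%:E <= C)%E.
  move=> pA A0 Ag; apply: ereal_sup_ubound; exists A; first by split => //; apply/eqP.
  by rewrite Ag inver gt_eqF ?l11normE ?enorm_gt0.
have C0 : (0 <= C)%E.
  have [A pA A0] := psd_neq0_exists T0.
  have [g [Ag g0 _ _]] := gamma_plus_psd pA.
  by apply: le_trans (CP _ _ pA A0 Ag); rewrite lee_fin divr_ge0 // l11normE enorm_ge0.
have [r [-> r0 rP _]] := rho1_fin T.
have pi_le : (pi_plus T <= r%:E * C)%E.
  apply: ge_ereal_sup => _ [A [pA A1] <-].
  have [->|A0] := eqVneq A 0.
    by rewrite mulmx0 mxtrace0 scalar_re0 mule_ge0.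
  have [g [Ag g0 gP g_max]] := gamma_plus_psd pA.
  apply: (@le_trans _ _ (r * (g / l11norm A))%:E); last first.
    by rewrite EFinM lee_wpmul2l // CP.
  rewrite lee_fin; apply: (@le_trans _ _ (r * g)); last first.
    apply: ler_wpM2l => //; rewrite ler_pdivlMr ?l11normE ?enorm_gt0 //.
    by rewrite ler_piMr.
  move: r0; rewrite le_eqVlt => /predU1P[r0|r0].
    have [s As] := psd_outer_sumP pA.
    by rewrite -r0 mul0r {1}As -(mul0r (l1sq_sum s)) r0 re_trace_outer_sum_le.
  rewrite -ler_pdivrMl //; apply: g_max => s As; rewrite ler_pdivrMl //.
  by rewrite As re_trace_outer_sum_le.
(* Here $0/0=0$ enters: $\rho_1(T)=0$ forces $\pi_+(T)=0$, as $0\cdot C=0$ even for infinite C. *)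
move: r0; rewrite le_eqVlt => /predU1P[r0|r0].
  suff -> : pi_plus T = 0%E by rewrite mul0e.
  by apply/le_anti; rewrite pi_plus_ge0 andbT; move: pi_le; rewrite -r0 mul0e.
by rewrite inver gt_eqF // lee_pdivrMr // muleC.
Qed.
End GaugeConstants.

Theorem theorem3p7 (R : realType) (K : scalar_kind) (n : nat) :
  gamma_const R K n =
    ereal_sup [set (gamma_plus A / (l11norm A)%:E)%E |
      A in @psd R K n `\ (0 : 'M[scalar_field R K]_n)] /\
  gamma_const R K n =
    ereal_sup [set (pi_plus T / rho1 T)%E |
      T in @selfadj R K n `\ (0 : 'M[scalar_field R K]_n)].
Proof.
split=> //; apply/le_anti/andP; split; apply: ge_ereal_sup.
  by move=> _ [A [pA /eqP A0] <-]; exact: ratio_gamma_le_sup.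
by move=> _ [T [sT /eqP T0] <-]; exact: ratio_pi_le_gamma_const.
Qed.
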